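(* Let $\nu,\rho\in\mathbb{R}$ and $n\in\{1,2,\dots\}$, where, if $\rho\leq 0$, it is assumed that $\nu<\rho$ (so that all the Krätzel functions below are defined). Let $Z_\rho^\mu(u)=\int_0^\infty t^{\mu-1}e^{-t^\rho-\frac{u}{t}}\,dt$. Then the function $$u\mapsto A_{\rho,n}^\nu(u)=\begin{vmatrix} Z_\rho^{\nu-\rho}(u) & Z_\rho^{\nu}(u) & \dots & Z_\rho^{\nu+(n-1)\rho}(u)\\ Z_\rho^{\nu}(u) & Z_\rho^{\nu+\rho}(u) & \dots & Z_\rho^{\nu+n\rho}(u)\\ \vdots & \vdots & & \vdots\\ Z_\rho^{\nu+(n-1)\rho}(u) & Z_\rho^{\nu+n\rho}(u) & \dots & Z_\rho^{\nu+(2n-1)\rho}(u)\end{vmatrix},$$ that is, the determinant of the $(n+1)\times(n+1)$ matrix whose $(i,j)$ entry is $Z_\rho^{\nu+(i+j-1)\rho}(u)$ for $i,j\in\{0,1,\dots,n\}$, is completely monotonic on $(0,\infty)$.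
   Context: The Krätzel function is defined for $u>0$, $\rho\in\mathbb{R}$ and $\mu\in\mathbb{R}$, with $\mu<0$ when $\rho\leq 0$ (so that the integral converges), by $Z_\rho^\mu(u)=\int_0^\infty t^{\mu-1}e^{-t^\rho-\frac{u}{t}}\,dt$. A function $f:(0,\infty)\to\mathbb{R}$ is completely monotonic if it has derivatives of all orders and $(-1)^m f^{(m)}(u)\geq 0$ for all $u>0$ and $m\in\{0,1,\dots\}$. *)

(* Defs.v *)
From HB Require Import structures.
From mathcomp Require Import all_boot all_order all_algebra.
From mathcomp Require Import all_classical all_reals all_analysis.
Import Order.TTheory GRing.Theory Num.Theory.
Import numFieldNormedType.Exports.

Set Implicit Arguments.
Unset Strict Implicit.
Unset Printing Implicit Defensive.

Local Open Scope classical_set_scope.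
Local Open Scope ring_scope.

(* [Rintegral] is total; the integrand is Lebesgue integrable on ]0, +oo[,
   and the value meaningful, when 0 < u and (rho <= 0 -> mu < 0). *)
Definition kratzel (R : realType) (rho mu u : R) : R :=
  \int[lebesgue_measure]_(t in `]0, +oo[)
    (t `^ (mu - 1) * expR (- (t `^ rho) - u / t)).

(* A function on ]0, +oo[ is represented by a total function whose values on
   ]-oo, 0] are irrelevant, since derivatives at u > 0 are local. *)
Definition completely_monotonic (R : realType) (f : R -> R) : Prop :=
  forall (m : nat) (u : R), 0 < u ->
    derivable (derive1n m f) u 1 /\ 0 <= (-1) ^+ m * derive1n m f u.

(* The exponent offset i + j - 1 is computed in R: it is -1 for i = j = 0. *)
Definition kratzel_mx (R : realType) (rho nu : R) (n : nat) (u : R)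
    : 'M[R]_n.+1 :=
  \matrix_(i < n.+1, j < n.+1)
    kratzel rho (nu + ((i + j)%:R - 1) * rho) u.

(* Main.v *)
Require Import Defs.
From HB Require Import structures.
From mathcomp Require Import all_boot all_order all_fingroup all_algebra.
From mathcomp Require Import all_classical all_reals all_analysis.
From mathcomp Require Import measurable_realfun ring lra.
Import Order.TTheory GRing.Theory Num.Theory.
Import numFieldNormedType.Exports.
Set Implicit Arguments.
Unset Strict Implicit.
Local Open Scope ring_scope.

(** Write [w] for [t `^ (nu - rho - 1) * expR (- (t `^ rho))] and [y] for
    [t `^ rho].  The [(i, j)] entry of the matrix is the moment
    [\int y ^+ (i + j) * w * expR (- u / t)], so the determinant is a Hankel
    determinant of moments and the Andreief identity turns it into
    [1 / (n+1)!] times the integral, over [t_0, ..., t_n > 0], of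
      [(\prod_(i < j) (y_j - y_i)) ^+ 2 * \prod_i w (t_i)
         * expR (- u * \sum_i 1 / t_i)].
    Each derivative in [u] multiplies the integrand by [- \sum_i 1 / t_i], so
    the signs alternate.

    No multiple integral is formed.  The objects handled are the finite sums
    [kratzel_sum c e] of products of Kraetzel functions with exponents [e a i],
    and the formal integrand of such a sum is, up to a positive weight, the
    generalized polynomial [\sum_a c a * \prod_i x i `^ e a i]; the data is
    called positive ([kratzel_positive]) when that is nonnegative for all
    positive [x].  Three facts give the theorem:
    - positivity of the data makes the sum nonnegative ([kratzel_sum_ge0]),
      which is proved by integrating out one variable at a time
      ([sum_prod_Rintegral_ge0]);
    - minus the derivative of [kratzel_sum c e] is again such a sum, with the
      polynomial multiplied by [\sum_i (x i)^-1] ([is_derive_kratzel_sum],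
      [kratzel_positive_deriv]), because the derivative of the Kraetzel
      function of exponent [mu] is minus the one of exponent [mu - 1]
      ([is_derive_kratzel]);
    - the determinant is such a sum, indexed by pairs of permutations, and its
      polynomial is a positive monomial times the square of a Vandermonde
      determinant ([det_kratzel_mxE], [kratzel_positive_det]). *)

(** * Integrability of the Kraetzel integrand *)

(** Since [1 + u * s / q <= expR (u * s / q)], the exponential beats the power
    with an explicit constant. *)
Lemma powR_expR_bounded (R : realType) (q u : R) : 0 < q -> 0 < u ->
  exists C : R, forall s : R, 0 <= s -> (1 + s) `^ q * expR (- (u * s)) <= C.
Proof.
move=> q0 u0; exists ((1 + q / u) `^ q) => s s0.
have qu0 : 0 <= q / u by rewrite divr_ge0 ?ltW.
have usq0 : 0 <= u * s / q by apply: divr_ge0; rewrite ?mulr_ge0 // ltW.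
rewrite expRN ler_pdivrMr ?expR_gt0//.
have -> : expR (u * s) = expR (u * s / q) `^ q.
  by rewrite -expRM divfK// gt_eqF.
rewrite -powRM ?expR_ge0 ?addr_ge0//.
apply: ge0_ler_powR; rewrite ?nnegrE ?mulr_ge0 ?expR_ge0 ?addr_ge0//.
  exact: ltW.
have: (1 + q / u) * (1 + u * s / q) <= (1 + q / u) * expR (u * s / q).
  by rewrite ler_wpM2l ?addr_ge0 ?expR_ge1Dx.
apply: le_trans.
have -> : (1 + q / u) * (1 + u * s / q) = 1 + s + (q / u + u * s / q).
  by field; rewrite !gt_eqF.
by rewrite lerDl addr_ge0.
Qed.

Lemma is_derive_powR1D (R : realType) (p t : R) : 0 <= t ->
  is_derive t 1 (fun t : R => (1 + t) `^ p) (p * (1 + t) `^ (p - 1)).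
Proof.
move=> t0; have t1 : 0 < 1 + t by rewrite ltr_wpDr.
have H1 := is_derive1_powR p t1.
have H2 : is_derive t 1 (fun t : R => 1 + t) (1 : R).
  have -> : (fun t : R => 1 + t) = cst (1 : R) + id by [].
  by apply: is_derive_eq; rewrite add0r.
rewrite -[X in is_derive _ _ _ X]mulr1.
exact: (@is_derive1_comp R (fun x : R => x `^ p) _ _ _ _ H1 H2).
Qed.

Lemma continuous_powR1D (R : realType) (p t : R) : 0 <= t ->
  {for t, continuous (fun t : R => (1 + t) `^ p)}.
Proof.
move=> t0; apply/differentiable_continuous/derivable1_diffP.
by have [] := is_derive_powR1D p t0.
Qed.

Lemma cvg_powR1Dy (R : realType) (p : R) : p < 0 ->
  ((1 + t) `^ p @[t --> +oo] --> (0 : R))%classic.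
Proof.
move=> p0; apply/cvgr0Pnorm_le => e e0; near=> t.
have t0 : 0 <= t by near: t; apply: nbhs_pinfty_ge; rewrite num_real.
have te : e `^ p^-1 <= t by near: t; apply: nbhs_pinfty_ge; rewrite num_real.
rewrite ger0_norm ?powR_ge0//.
have -> : e = ((e `^ p^-1) `^ (- p))^-1.
  by rewrite -powRN opprK -powRrM mulVf ?lt_eqF// powRr1// ltW.
rewrite -[X in (1 + t) `^ X]opprK (powRN (1 + t)).
rewrite lef_pV2 ?posrE ?powR_gt0//; last first.
  by rewrite ltr_wpDr.
apply: ge0_ler_powR; rewrite ?nnegrE ?powR_ge0 ?addr_ge0 ?oppr_ge0//.
  exact: ltW.
by rewrite (le_trans te)// lerDr.
Unshelve. all: by end_near. Qed.

(** The dominating functions below are all multiples of this one; shifting the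
    variable by [1] makes it bounded near [0], so that a single comparison
    covers both ends of the half-line. *)
Lemma integrable_powR1D (R : realType) (p : R) : p < 0 ->
  (@lebesgue_measure R).-integrable `]0, +oo[%classic
    (EFin \o (fun t => (1 + t) `^ (p - 1))).
Proof.
move=> p0.
have mf : measurable_fun [set: R] (fun t : R => (1 + t) `^ (p - 1)).
  apply: (measurableT_comp (measurable_powR (p - 1))).
  exact: measurable_funD.
have dF (t : R) : 0 <= t ->
    is_derive t 1 (p^-1 *: (fun t : R => (1 + t) `^ p)) ((1 + t) `^ (p - 1)).
  move=> t0; have := is_derive_powR1D p t0 => ?.
  by apply: is_derive_eq; rewrite /GRing.scale/= mulKf// lt_eqF.
apply/integrableP; split; first by apply/measurable_EFinP/measurable_funTS.
under eq_integral do rewrite /= ger0_norm ?powR_ge0//.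
rewrite integral_itv_obnd_cbnd; last by apply/measurable_EFinP/measurable_funTS.
rewrite (@ge0_continuous_FTC2y _ _ (p^-1 *: (fun t : R => (1 + t) `^ p)) 0 0).
- by rewrite -EFinB ltry.
- by move=> x _; exact: powR_ge0.
- apply/continuous_within_itvcyP; split.
    by move=> x; rewrite in_itv/= andbT => x0; apply/continuous_powR1D/ltW.
  by apply: cvg_at_right_filter; exact: continuous_powR1D.
- by rewrite -(scaler0 _ p^-1); apply: cvgZr; exact: cvg_powR1Dy.
- by move=> x x0; have [] := dF _ (ltW x0).
- apply: cvg_at_right_filter; apply: cvgZr; exact: continuous_powR1D.
- by move=> x; rewrite in_itv/= andbT => /ltW/dF [_ <-]; rewrite derive1E.
Qed.

Lemma integrableZl_EFin {d : measure_display} {T : measurableType d}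
    {R : realType} (mu : {measure set T -> \bar R}) (D : set T) (k : R) f :
  measurable D -> mu.-integrable D (EFin \o f) ->
  mu.-integrable D (EFin \o (fun t => k * f t)).
Proof.
by move=> mD intf; rewrite /comp; under eq_fun do rewrite EFinM;
  exact: integrableZl.
Qed.

Definition kratzel_integrand (R : realType) (rho mu u t : R) : R :=
  t `^ (mu - 1) * expR (- (t `^ rho) - u / t).

(** The condition on the exponent under which the Kraetzel integral
    converges. *)
Definition kratzel_admissible (R : realType) (rho mu : R) : Prop :=
  rho <= 0 -> mu < 0.

Lemma kratzel_integrand_ge0 (R : realType) (rho mu u t : R) :
  0 <= kratzel_integrand rho mu u t.
Proof. by rewrite mulr_ge0 ?powR_ge0 ?expR_ge0. Qed.

(** At infinity the integrand decays like a power with exponent less than [-1]: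
    for [rho <= 0] this is the admissibility of [mu], and for [0 < rho] the
    factor [expR (- (t `^ rho))] absorbs any power of [t]. *)
Lemma powR_expR_powR_le (R : realType) (rho mu : R) :
  kratzel_admissible rho mu ->
  exists p C : R, [/\ p < 0, 0 <= C & forall t : R, 0 < t ->
    t `^ (mu - 1) * expR (- (t `^ rho)) <= C * t `^ (p - 1)].
Proof.
move=> adm; have [rho0|rho0] := leP rho 0.
  exists mu, 1; split=> //; first exact: adm.
  move=> t t0; rewrite mul1r ler_piMr ?powR_ge0//.
  by rewrite expR_le1 oppr_le0 powR_ge0.
(* Any negative p below mu would do. *)
pose p : R := Num.min mu 0 - 1.
have p0 : p < 0 by rewrite /p subr_lt0 gt_min ltr01 orbT.
have a0 : 0 < mu - p.
  by rewrite subr_gt0 /p ltrBlDr gt_min ltrDl ltr01.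
have [C HC] := powR_expR_bounded (divr_gt0 a0 rho0) ltr01.
exists p, C; split => //.
  by apply: le_trans (HC 0 (lexx 0)); rewrite mulr_ge0 ?powR_ge0 ?expR_ge0.
move=> t t0.
have -> : mu - 1 = (p - 1) + (mu - p) by ring.
rewrite powRD; last by rewrite (gt_eqF t0) implybT.
rewrite -mulrA mulrC ler_wpM2r ?powR_ge0//.
apply: le_trans (HC _ (powR_ge0 t rho)).
rewrite mul1r ler_wpM2r ?expR_ge0//.
have -> : t `^ (mu - p) = (t `^ rho) `^ ((mu - p) / rho).
  by rewrite -powRrM mulrC divfK// gt_eqF.
apply: ge0_ler_powR; rewrite ?nnegrE ?powR_ge0 ?addr_ge0 ?powR_ge0//.
  by apply/ltW/divr_gt0.
by rewrite lerDr.
Qed.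

(** Near [0] it is [expR (- u / t)] that absorbs the power of [t], by
    [powR_expR_bounded] at [s = 1 / t]. *)
Lemma kratzel_integrand_le_powR1D (R : realType) (rho mu u : R) :
  kratzel_admissible rho mu -> 0 < u ->
  exists p C : R, p < 0 /\ forall t : R, 0 < t ->
    kratzel_integrand rho mu u t <= C * (1 + t) `^ (p - 1).
Proof.
move=> /powR_expR_powR_le[p [C [p0 C0 HC]]] u0.
have q0 : 0 < 1 - p by rewrite subr_gt0 (lt_trans p0).
have [C' HC'] := powR_expR_bounded q0 u0.
exists p, (C * C'); split=> // t t0.
have t10 : 0 < 1 + t by rewrite ltr_wpDr// ltW.
rewrite /kratzel_integrand expRD mulrA.
apply: le_trans (ler_wpM2r (expR_ge0 _) (HC t t0)) _.
rewrite -!mulrA ler_wpM2l//.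
have ti0 : 0 <= t^-1 by rewrite invr_ge0 ltW.
apply: le_trans (ler_wpM2r (powR_ge0 _ _) (HC' _ ti0)).
rewrite mulrAC ler_wpM2r ?expR_ge0//.
have -> : t `^ (p - 1) = (t^-1) `^ (1 - p).
  by rewrite -powR_inv1 ?(ltW t0)// -powRrM mulN1r opprB.
have {1}-> : t^-1 = (1 + t^-1) * (1 + t)^-1 by field; rewrite !gt_eqF.
rewrite powRM ?addr_ge0// ?invr_ge0; last exact: ltW.
by rewrite -(powR_inv1 (ltW t10)) -powRrM mulN1r opprB.
Qed.

(** [u / t] is replaced by [u * t `^ (-1)], which agrees with it on the
    half-line and is measurable everywhere. *)
Lemma measurable_kratzel_integrand (R : realType) (rho mu u : R) :
  measurable_fun (`]0, +oo[%classic : set R) (kratzel_integrand rho mu u).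
Proof.
apply: (@eq_measurable_fun _ _ _ _ _
    (fun t => t `^ (mu - 1) * expR (- (t `^ rho) - u * t `^ (-1)))).
  move=> t; rewrite inE/= in_itv/= andbT => t0.
  by rewrite powR_inv1// ltW.
apply: measurable_funTS; apply: measurable_funM; first exact: measurable_powR.
apply: measurableT_comp => //; apply: measurable_funB.
  by apply: measurableT_comp => //; exact: measurable_powR.
by apply: measurable_funM => //; exact: measurable_powR.
Qed.

Lemma integrable_kratzel_integrand (R : realType) (rho mu u : R) :
  kratzel_admissible rho mu -> 0 < u ->
  (@lebesgue_measure R).-integrable `]0, +oo[%classic
    (EFin \o kratzel_integrand rho mu u).
Proof.
move=> adm u0; have [p [C [p0 HC]]] := kratzel_integrand_le_powR1D adm u0.
apply: le_integrable (integrableZl_EFin C _ (integrable_powR1D p0)) => //.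
  by apply/measurable_EFinP; exact: measurable_kratzel_integrand.
move=> t /=; rewrite in_itv/= andbT => t0.
rewrite lee_fin ger0_norm ?kratzel_integrand_ge0//.
by apply: le_trans (HC _ t0) _; exact: ler_norm.
Qed.

Lemma kratzel_admissibleB (R : realType) (rho mu k : R) : 0 <= k ->
  kratzel_admissible rho mu -> kratzel_admissible rho (mu - k).
Proof.
by move=> k0 adm /adm mu0; rewrite ltrBlDr (lt_le_trans mu0)// add0r.
Qed.

(** * Differentiation of the Kraetzel function *)

Lemma is_derive_kratzel_integrand (R : realType) (rho mu u t : R) : 0 < t ->
  is_derive u 1 (fun v => kratzel_integrand rho mu v t)
    (- kratzel_integrand rho (mu - 1) u t).
Proof.
move=> t0; rewrite /kratzel_integrand.
have H2 : is_derive u 1 (fun v : R => - (t `^ rho) - v / t) (- t^-1).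
  have -> : (fun v : R => - (t `^ rho) - v / t)
      = cst (- (t `^ rho)) + (- t^-1) *: id.
    by apply/funext => v; rewrite !fctE/= /GRing.scale/= mulNr mulrC.
  by apply: is_derive_eq; rewrite add0r [_ *: _]mulr1.
have H3 := @is_derive1_comp R expR _ _ _ _ (is_derive_expR _) H2.
have -> : (fun v : R => t `^ (mu - 1) * expR (- t `^ rho - v / t))
   = t `^ (mu - 1) *: (expR \o (fun v : R => - (t `^ rho) - v / t)) by [].
apply: is_derive_eq.
rewrite [_ *: _](_ : _ =
  t `^ (mu - 1) * (expR (- t `^ rho - u / t) * - t^-1))//.
rewrite [t `^ (mu - 1 - 1)]powRB; last by rewrite (gt_eqF t0) implybT.
rewrite powRr1; last exact: ltW.
by ring.
Qed.

(** Differentiation under the integral sign: the [u]-derivative of the integrand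
    is minus the integrand of exponent [mu - 1], which decreases in absolute
    value with [u]; on a neighbourhood of [u] bounded below by [u / 2] it is
    therefore dominated by its value at [u / 2]. *)
Lemma is_derive_kratzel (R : realType) (rho mu u : R) :
  kratzel_admissible rho mu -> 0 < u ->
  is_derive u 1 (kratzel rho mu) (- kratzel rho (mu - 1) u).
Proof.
move=> adm u0.
have adm1 := kratzel_admissibleB ler01 adm.
have u2 : 0 < u / 2 by rewrite divr_gt0.
have Iu : `](u / 2), (u + 1)[%classic u.
  by rewrite /= in_itv/= ltrDl ltr01 andbT gtr_pMr// invf_lt1// ltr1n.
have pos v : `](u / 2), (u + 1)[%classic v -> 0 < v.
  by rewrite /= in_itv/= => /andP[/(lt_trans u2)].
have d1 v t : 0 < t -> partial1of2 (kratzel_integrand rho mu) v t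
    = - kratzel_integrand rho (mu - 1) v t.
  move=> t0; rewrite partial1of2E.
  by have [_ ->] := is_derive_kratzel_integrand rho mu v t0.
have intf v : `](u / 2), (u + 1)[%classic v ->
    (@lebesgue_measure R).-integrable `]0, +oo[%classic
      (EFin \o kratzel_integrand rho mu v).
  by move=> /pos; exact: integrable_kratzel_integrand.
have derf v t : `](u / 2), (u + 1)[%classic v -> `]0, +oo[%classic t ->
    derivable (fun v => kratzel_integrand rho mu v t) v 1.
  rewrite /= [t \in _]in_itv/= andbT => _ t0.
  by have [] := is_derive_kratzel_integrand rho mu v t0.
have Gint := integrable_kratzel_integrand adm1 u2.
have Gub v t : `](u / 2), (u + 1)[%classic v -> `]0, +oo[%classic t ->
    `|partial1of2 (kratzel_integrand rho mu) v t|
      <= kratzel_integrand rho (mu - 1) (u / 2) t.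
  rewrite /= !in_itv/= andbT => /andP[uv _] t0.
  rewrite d1// normrN ger0_norm ?kratzel_integrand_ge0//.
  rewrite ler_wpM2l ?powR_ge0// ler_expR lerD2l lerN2 ler_wpM2r ?invr_ge0//.
    exact: ltW.
  exact: ltW.
have mI : measurable (`]0, +oo[%classic : set R) by [].
have G0 t := kratzel_integrand_ge0 rho (mu - 1) (u / 2) t.
apply: DeriveDef.
  exact: (@derivable_under_integral R _ _ (@lebesgue_measure R)
    (kratzel_integrand rho mu) _ mI _ _ _ Iu intf derf _ G0 Gint Gub).
rewrite -derive1E.
have -> := @differentiation_under_integral R _ _ (@lebesgue_measure R)
    (kratzel_integrand rho mu) _ mI _ _ _ Iu intf derf _ G0 Gint Gub.
transitivity (-1 * kratzel rho (mu - 1) u); last by rewrite mulN1r.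
rewrite /kratzel -RintegralZl//; last exact: integrable_kratzel_integrand.
apply: eq_Rintegral => t; rewrite inE/= in_itv/= andbT => t0.
by rewrite d1// mulN1r.
Qed.

(** * Sums of products of integrals *)

Lemma Rintegral_sum {d : measure_display} {T : measurableType d}
    {R : realType} (mu : {measure set T -> \bar R}) (D : set T)
    (I : finType) (f : I -> T -> R) :
  measurable D -> (forall a, mu.-integrable D (EFin \o f a)) ->
  \int[mu]_(t in D) (\sum_a f a t) = \sum_a \int[mu]_(t in D) f a t.
Proof.
move=> mD intf; rewrite /Rintegral.
under eq_integral do rewrite -sumEFin.
rewrite integral_sum//.
have -> : (\sum_a \int[mu]_(t in D) (f a t)%:E =
    (\sum_a fine (\int[mu]_(t in D) (f a t)%:E))%:E)%E.
  rewrite -sumEFin; apply: eq_bigr => a _; rewrite fineK//.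
  by apply: (integrable_fin_num mD) (intf a).
by [].
Qed.

(** Positivity of a tensor power of the integral, seen on finite sums of
    products: integrating one variable of a nonnegative function leaves a
    nonnegative function of the others.  The induction on [N] integrates the
    first variable and moves the resulting scalars into [c]. *)
Lemma sum_prod_Rintegral_ge0 {d : measure_display} {T : measurableType d}
    {R : realType} (mu : {measure set T -> \bar R}) (D : set T)
    (I : finType) (N : nat) (c : I -> R) (f : I -> 'I_N -> T -> R) :
  measurable D -> (forall a i, mu.-integrable D (EFin \o f a i)) ->
  (forall t : 'I_N -> T, (forall i, D (t i)) ->
     0 <= \sum_a c a * \prod_i f a i (t i)) ->
  0 <= \sum_a c a * \prod_i \int[mu]_(t in D) f a i t.
Proof.
move=> mD; elim: N c f => [|N IH] c f intf f_ge0.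
  (* With no variable left there is a single, vacuous point t. *)
  have := f_ge0 (fun i => False_rect _ (notF (ltn_ord i))).
  under eq_bigr do rewrite big_ord0.
  under [in X in _ -> X]eq_bigr do rewrite big_ord0.
  by apply; case.
under eq_bigr do rewrite big_ord_recl mulrA.
apply: IH => // t Dt.
have -> : \sum_a c a * (\int[mu]_(s in D) f a ord0 s)
      * \prod_i f a (lift ord0 i) (t i)
    = \int[mu]_(s in D) \sum_a (c a * \prod_i f a (lift ord0 i) (t i))
        * f a ord0 s.
  rewrite Rintegral_sum//; last by move=> a; exact: integrableZl_EFin.
  by apply: eq_bigr => a _; rewrite RintegralZl// mulrAC.
apply: Rintegral_ge0 => s Ds.
have := f_ge0 (fun i => oapp t s (unlift ord0 i)).
have -> : \sum_a c a * \prod_i f a i (oapp t s (unlift ord0 i))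
    = \sum_a (c a * \prod_i f a (lift ord0 i) (t i)) * f a ord0 s.
  apply: eq_bigr => a _; rewrite big_ord_recl unlift_none/= mulrCA mulrC.
  by congr (_ * _ * _); apply: eq_bigr => i _; rewrite liftK.
by apply => i; case: unliftP => [j _|_] /=.
Qed.

(** * Sums of products of Kraetzel functions *)

Definition kratzel_sum (R : realType) (rho : R) (I : finType) (N : nat)
    (c : I -> R) (e : I -> 'I_N -> R) (u : R) : R :=
  \sum_a c a * \prod_i kratzel rho (e a i) u.

(** The integrand of exponent [mu] is [t `^ mu] times a positive factor that
    does not depend on [mu], hence the condition on pure powers. *)
Definition kratzel_positive (R : realType) (rho : R) (I : finType) (N : nat)
    (c : I -> R) (e : I -> 'I_N -> R) : Prop :=
  (forall a i, kratzel_admissible rho (e a i)) /\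
  forall x : 'I_N -> R, (forall i, 0 < x i) ->
    0 <= \sum_a c a * \prod_i x i `^ e a i.

Lemma kratzel_sum_ge0 (R : realType) (rho : R) (I : finType) (N : nat)
    (c : I -> R) (e : I -> 'I_N -> R) (u : R) :
  kratzel_positive rho c e -> 0 < u -> 0 <= kratzel_sum rho c e u.
Proof.
move=> [adm pos] u0; apply: (@sum_prod_Rintegral_ge0 _ _ _
  (@lebesgue_measure R) _ _ _ c (fun a i => kratzel_integrand rho (e a i) u)).
- by [].
- by move=> a i; exact: integrable_kratzel_integrand.
move=> t Dt.
have t0 i : 0 < t i by have := Dt i; rewrite /= in_itv/= andbT.
have -> : \sum_a c a * \prod_i kratzel_integrand rho (e a i) u (t i)
    = (\sum_a c a * \prod_i t i `^ e a i)
      * \prod_i ((t i)^-1 * expR (- (t i `^ rho) - u / t i)).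
  rewrite mulr_suml; apply: eq_bigr => a _.
  rewrite -mulrA -big_split/=; congr (_ * _); apply: eq_bigr => i _.
  rewrite /kratzel_integrand powRB; last by rewrite (gt_eqF (t0 i)) implybT.
  by rewrite powRr1 ?(ltW (t0 i))// mulrA.
apply: mulr_ge0; first exact: pos.
by apply: prodr_ge0 => i _; rewrite mulr_ge0 ?expR_ge0// invr_ge0 ltW.
Qed.

(** By the Leibniz rule, the terms of the derivative are indexed by a term [a]
    together with the position [j] of the differentiated factor, whose exponent
    drops by one. *)
Definition deriv_coef (R : realType) (I : finType) (N : nat) (c : I -> R)
  (a : I * 'I_N) : R := c a.1.

Definition deriv_expo (R : realType) (I : finType) (N : nat)
  (e : I -> 'I_N -> R) (a : I * 'I_N) (i : 'I_N) : R := e a.1 i - (i == a.2)%:R.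

Lemma kratzel_positive_deriv (R : realType) (rho : R) (I : finType) (N : nat)
    (c : I -> R) (e : I -> 'I_N -> R) :
  kratzel_positive rho c e ->
  kratzel_positive rho (@deriv_coef R I N c) (deriv_expo e).
Proof.
move=> [adm pos]; split => [a i|x x0]; first exact: kratzel_admissibleB.
have -> : \sum_a deriv_coef c a * \prod_i x i `^ deriv_expo e a i
    = (\sum_a c a * \prod_i x i `^ e a i) * \sum_j (x j)^-1.
  rewrite big_distrlr/= pair_bigA; apply: eq_bigr => -[a j] _ /=.
  rewrite /deriv_coef /deriv_expo /= -mulrA; congr (_ * _).
  rewrite (bigD1 j)//= [in RHS](bigD1 j)//= eqxx mulrAC; congr (_ * _).
    rewrite powRB; last by rewrite (gt_eqF (x0 j)) implybT.
    by rewrite powRr1// ltW.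
  by apply: eq_bigr => i /negbTE ->; rewrite subr0.
by rewrite mulr_ge0 ?pos// sumr_ge0// => j _; rewrite invr_ge0 ltW.
Qed.

Lemma is_derive_prodf (R : realType) N (f : 'I_N -> R -> R) (df : 'I_N -> R)
    (u : R) : (forall i, is_derive u 1 (f i) (df i)) ->
  is_derive u 1 (fun x => \prod_i f i x)
    (\sum_j \prod_i (if i == j then df i else f i u)).
Proof.
elim: N f df => [|N IH] f df Hf.
  rewrite big_ord0.
  have -> : (fun x => \prod_i f i x) = cst 1.
    by apply/funext => x; rewrite big_ord0.
  exact: is_derive_cst.
have -> : (fun x => \prod_i f i x)
    = (f ord0) * (fun x => \prod_(i < N) f (lift ord0 i) x).
  by apply/funext => x; rewrite big_ord_recl.
have := IH (fun i => f (lift ord0 i)) _ (fun i => Hf (lift ord0 i)) => Hg.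
apply: is_derive_eq.
rewrite big_ord_recl [LHS]addrC; congr (_ + _).
  by rewrite big_ord_recl eqxx mulrC; congr (_ * _).
rewrite scaler_sumr; apply: eq_bigr => j _.
by rewrite [in RHS]big_ord_recl (negbTE (neq_lift _ _)); congr (_ * _).
Qed.

Lemma is_derive_sumf (R : realType) (I : finType) (f : I -> R -> R)
    (df : I -> R) (u : R) : (forall a, is_derive u 1 (f a) (df a)) ->
  is_derive u 1 (fun x => \sum_a f a x) (\sum_a df a).
Proof.
move=> Hf; have -> : (fun x => \sum_a f a x) = \sum_a f a.
  by apply/funext => x; rewrite fct_sumE.
elim/big_ind2 : _ => // [|g dg h dh Hg Hh]; first exact: is_derive_cst.
exact: is_deriveD.
Qed.

Lemma is_derive_kratzel_sum (R : realType) (rho : R) (I : finType) (N : nat)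
    (c : I -> R) (e : I -> 'I_N -> R) (u : R) :
  kratzel_positive rho c e -> 0 < u ->
  is_derive u 1 (kratzel_sum rho c e)
    (- kratzel_sum rho (@deriv_coef R I N c) (deriv_expo e) u).
Proof.
move=> [adm _] u0.
have Hp a := is_derive_prodf (fun i => is_derive_kratzel (adm a i) u0).
have Hs := is_derive_sumf (fun a => is_deriveZ (c a) (Hp a)).
apply: is_derive_eq Hs _.
rewrite /kratzel_sum -(pair_bigA _ (fun a j => deriv_coef c (a, j) *
  \prod_i kratzel rho (deriv_expo e (a, j) i) u))/=.
rewrite -sumrN; apply: eq_bigr => a _.
rewrite -sumrN [_ *: _]mulr_sumr; apply: eq_bigr => j _.
rewrite /deriv_coef /deriv_expo/= -mulrN; congr (_ * _).
rewrite (bigD1 j)//= [in RHS](bigD1 j)//= !eqxx mulNr; congr (- (_ * _)).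
by apply: eq_bigr => i /negbTE ->; rewrite subr0.
Qed.

Lemma derive1n_kratzel_sum (R : realType) (rho : R) (I : finType) (N : nat)
    (c : I -> R) (e : I -> 'I_N -> R) (m : nat) : kratzel_positive rho c e ->
  exists (J : finType) (c' : J -> R) (e' : J -> 'I_N -> R),
    kratzel_positive rho c' e' /\ forall u, 0 < u ->
      derive1n m (kratzel_sum rho c e) u = (-1) ^+ m * kratzel_sum rho c' e' u.
Proof.
move=> pos; elim: m => [|m [J [c' [e' [pos' IH]]]]].
  by exists I, c, e; split => // u u0; rewrite mul1r.
exists _, (@deriv_coef R J N c'), (deriv_expo e').
split; first exact: kratzel_positive_deriv.
move=> u u0; rewrite derive1nS derive1E.
have Hd := is_derive_kratzel_sum pos' u0.
have Hn : \forall v \near u, ((-1) ^+ m *: kratzel_sum rho c' e') v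
    = derive1n m (kratzel_sum rho c e) v.
  by near=> v; rewrite IH//; near: v; exact: lt_nbhsr.
have [_ ->] := near_eq_is_derive Hn (is_deriveZ ((-1) ^+ m) Hd).
by rewrite exprS mulN1r mulNr [LHS]mulrN.
Unshelve. all: by end_near. Qed.

Lemma completely_monotonic_kratzel_sum (R : realType) (rho : R) (I : finType)
    (N : nat) (c : I -> R) (e : I -> 'I_N -> R) :
  kratzel_positive rho c e -> completely_monotonic (kratzel_sum rho c e).
Proof.
move=> pos m u u0; have [J [c' [e' [pos' Hm]]]] := derive1n_kratzel_sum m pos.
split.
  have Hd := is_derive_kratzel_sum pos' u0.
  have Hn : \forall v \near u, ((-1) ^+ m *: kratzel_sum rho c' e') v
      = derive1n m (kratzel_sum rho c e) v.
    by near=> v; rewrite Hm//; near: v; exact: lt_nbhsr.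
  by have [] := near_eq_is_derive Hn (is_deriveZ ((-1) ^+ m) Hd).
rewrite Hm// mulrA -exprD addnn -mul2n exprM sqrrN !expr1n mul1r.
exact: kratzel_sum_ge0.
Unshelve. all: by end_near. Qed.

(** * The determinant *)

(** The expansion of the square of a determinant: [st.1] and [st.2] index the
    two Vandermonde factors. *)
Definition det_coef (R : realType) (N : nat) (st : 'S_N * 'S_N) : R :=
  (N`!)%:R^-1 * ((-1) ^+ st.1 * (-1) ^+ st.2).

Definition det_expo (R : realType) (nu rho : R) (N : nat) (st : 'S_N * 'S_N)
  (i : 'I_N) : R := nu + ((st.1 i + st.2 i)%:R - 1) * rho.

(** For a fixed permutation [s], substituting [s * t] for the second permutation
    and reindexing the product along [s] recovers the Leibniz expansion of the
    determinant; hence each of the [(n+1)!] choices of [s] contributes the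
    same amount. *)
Lemma det_kratzel_mxE (R : realType) (nu rho : R) (n : nat) (u : R) :
  \det (kratzel_mx rho nu n u)
  = kratzel_sum rho (@det_coef R n.+1) (det_expo nu rho (N:=n.+1)) u.
Proof.
rewrite /kratzel_sum -(pair_bigA _ (fun s t => det_coef R (s, t) *
  \prod_i kratzel rho (det_expo nu rho (s, t) i) u))/=.
have Hs (s : 'S_n.+1) : \sum_(t : 'S_n.+1) det_coef R (s, t) *
    \prod_i kratzel rho (det_expo nu rho (s, t) i) u
    = ((n.+1)`!)%:R^-1 * \det (kratzel_mx rho nu n u).
  rewrite (reindex_inj (mulgI s))/= /determinant mulr_sumr.
  apply: eq_bigr => t _.
  rewrite /det_coef /= odd_permM signr_addb mulrA -signr_addb addbb mul1r.
  rewrite -mulrA.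
  congr (_ * (_ * _)).
  rewrite [in RHS](reindex_inj (@perm_inj _ s))/=; apply: eq_bigr => i _.
  by rewrite mxE /det_expo/= permM.
rewrite (eq_bigr _ (fun s _ => Hs s)) sumr_const card_Sn.
by rewrite -[RHS]mulr_natl mulrA mulfV ?mul1r// pnatr_eq0 -lt0n fact_gt0.
Qed.

Lemma kratzel_admissible_step (R : realType) (nu rho : R) (k : nat) :
  (rho <= 0 -> nu < rho) -> kratzel_admissible rho (nu + (k%:R - 1) * rho).
Proof.
move=> H rho0; have := H rho0 => nurho.
have -> : nu + (k%:R - 1) * rho = (nu - rho) + k%:R * rho by ring.
by have := mulr_ge0_le0 (ler0n R k) rho0; lra.
Qed.

(** The double sum factors as the square of the Vandermonde determinant [V] of
    the [x i `^ rho]. *)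
Lemma kratzel_positive_det (R : realType) (nu rho : R) (N : nat) :
  (rho <= 0 -> nu < rho) ->
  kratzel_positive rho (@det_coef R N) (det_expo nu rho (N:=N)).
Proof.
move=> H; split => [a i|x x0]; first exact: kratzel_admissible_step.
pose V : R := \sum_(s : 'S_N) (-1) ^+ s * \prod_i (x i `^ rho) ^+ (s i).
have -> : \sum_a det_coef R a * \prod_i x i `^ det_expo nu rho a i
    = (N`!%:R^-1 * \prod_i x i `^ (nu - rho)) * (V * V).
  rewrite /V big_distrlr/= pair_bigA mulr_sumr; apply: eq_bigr => -[s t] _ /=.
  have -> : \prod_i x i `^ det_expo nu rho (s, t) i
      = \prod_i x i `^ (nu - rho) * (\prod_i (x i `^ rho) ^+ s i
        * \prod_i (x i `^ rho) ^+ t i).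
    rewrite -!big_split/=; apply: eq_bigr => i _.
    rewrite -exprD -powR_mulrn ?powR_ge0// -powRrM -powRD; last first.
      by rewrite (gt_eqF (x0 i)) implybT.
    by congr (_ `^ _); rewrite /det_expo/=; ring.
  by rewrite /det_coef [X in _ = _ * X]mulrACA [RHS]mulrACA.
rewrite mulr_ge0//; last by rewrite -expr2 sqr_ge0.
rewrite mulr_ge0 ?invr_ge0//.
by apply: prodr_ge0 => i _; exact: powR_ge0.
Qed.

Theorem theorem2 (R : realType) (nu rho : R) (n : nat)
    (n_ge1 : (1 <= n)%N) (nu_lt_rho : rho <= 0 -> nu < rho) :
  completely_monotonic (fun u : R => \det (kratzel_mx rho nu n u)).
Proof.
rewrite (_ : (fun u => _) =
    kratzel_sum rho (@det_coef R n.+1) (det_expo nu rho (N:=n.+1))); last first.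
  by apply/funext => u; exact: det_kratzel_mxE.
exact/completely_monotonic_kratzel_sum/kratzel_positive_det.
Qed.
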